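(* Let $k\ge 2$ be an integer and let $G$ be a connected $P_k$-free graph. Then $b(G)\le \left\lceil \frac{k+1}{2}\right\rceil$.
   Context: A graph is $P_k$-free if it contains no induced subgraph isomorphic to the path on $k$ vertices. For a finite simple graph $G$, a burning sequence is a sequence $(b_1,\dots,b_t)$ of vertices such that every vertex $v$ satisfies $d_G(v,b_i)\le t-i$ for some $i\in\{1,\dots,t\}$; the burning number $b(G)$ is the minimum length of a burning sequence. *)

(* Defs.v *)
From mathcomp Require Import all_boot.

Set Implicit Arguments.
Unset Strict Implicit.
Unset Printing Implicit Defensive.

Record sgraph := SGraph {
  vertex :> finType;
  adj : rel vertex;
  adj_sym : symmetric adj;
  adj_irrefl : irreflexive adj
}.

(* Satisfied by the graph with no vertices. *)
Definition connected_graph (G : sgraph) : Prop :=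
  forall x y : G, connect (@adj G) x y.

Definition path_adj k : rel 'I_k :=
  [rel i j : 'I_k | (i.+1 == j :> nat) || (j.+1 == i :> nat)].

Lemma path_adj_sym k : symmetric (@path_adj k).
Proof. by move=> i j; rewrite /path_adj /= orbC. Qed.

Lemma path_adj_irrefl k : irreflexive (@path_adj k).
Proof. by move=> i; rewrite /path_adj /= orbb; apply: gtn_eqF. Qed.

(* k is the number of vertices, not of edges. *)
Definition path_graph k : sgraph :=
  SGraph (@path_adj_sym k) (@path_adj_irrefl k).

Definition has_induced (G H : sgraph) : Prop :=
  exists2 f : H -> G, injective f & forall x y : H, adj (f x) (f y) = adj x y.

Definition path_free k (G : sgraph) : Prop := ~ has_induced G (path_graph k).

Section Burning.
Variable G : sgraph.

Definition walk (x y : G) (n : nat) : bool :=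
  [exists p : n.-tuple G, path (@adj G) x p && (last x p == y)].

Lemma connect_walk x y : connect (@adj G) x y -> exists n, walk x y n.
Proof.
case/connectP=> p px ->; exists (size p).
by apply/existsP; exists (in_tuple p); rewrite px eqxx.
Qed.

(* None stands for the infinite distance between distinct components. *)
Definition gdist (x y : G) : option nat :=
  match boolP (connect (@adj G) x y) with
  | AltTrue cxy => Some (ex_minn (connect_walk cxy))
  | AltFalse _ => None
  end.

Definition gdist_le (x y : G) (n : nat) : bool :=
  if gdist x y is Some d then d <= n else false.

(* The 0-based index i : 'I_t stands for i+1 in {1, ..., t}. *)
Definition burning_seq t (b : t.-tuple G) : bool :=
  [forall v : G, exists i : 'I_t, gdist_le v (tnth b i) (t - i.+1)].

Definition burnable t : bool := [exists b : t.-tuple G, burning_seq b].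

Lemma gdist_leP x y n :
  reflect (exists2 m, walk x y m & m <= n) (gdist_le x y n).
Proof.
rewrite /gdist_le /gdist; case: {-}_ / boolP => [cxy|ncxy].
  case: ex_minnP => d wd mind; apply: (iffP idP) => [le|[m wm lemn]].
    by exists d.
  exact: leq_trans (mind _ wm) lemn.
apply: ReflectF => -[m /existsP[p /andP[px /eqP ly]] _].
by case/negP: ncxy; apply/connectP; exists p.
Qed.

Lemma ex_burnable : exists t, burnable t.
Proof.
exists #|G|; apply/existsP; exists (enum_tuple G); apply/forallP=> v.
apply/existsP; exists (enum_rank v); apply/gdist_leP; exists 0 => //.
apply/existsP; exists [tuple] => /=.
by rewrite (tnth_nth v) /= nth_enum_rank.
Qed.

Definition burning_number : nat := ex_minn ex_burnable.

End Burning.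

(* Main.v *)
Require Import Defs.
From mathcomp Require Import all_boot zify.

(** Write t = ceil((k+1)/2), so that k <= 2t-1 and t >= 2.  By a theorem of
    Erdős, Saks and Sós, a connected graph in which every vertex has
    eccentricity at least r contains an induced path on 2r-1 vertices; hence a
    P_k-free connected graph has a vertex c of eccentricity at most t-1, and
    burning c first suffices.

    For the theorem of Erdős, Saks and Sós one deletes non-cut vertices as long
    as all eccentricities stay at least r.  When this is no longer possible for
    a non-cut vertex v, there is a vertex c within distance r-1 of all vertices
    but v, and d(c,v) = r.  Let c = x_0, x_1, ..., x_r = v be a geodesic and
    let w be at distance at least r from x_2.  Then r-2 <= d(c,w) <= r-1, and
    for a geodesic c = q_0, ..., q_s = w distances from c and from x_2 exclude
    all adjacencies between the x_i and the q_j with i, j >= 1 other than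
    x_1 q_1, which is possible only if s = r-1.  Without that edge the two
    geodesics together form an induced path on r+1+s vertices; with it, they do
    so after c is removed, on 2r-1 vertices. *)

Set Implicit Arguments.
Unset Strict Implicit.
Unset Printing Implicit Defensive.

(** * Walks and induced paths *)

Section Walks.
Variable G : sgraph.
Implicit Types (x y z : G) (f h : nat -> G).

Lemma walkP x y n :
  reflect (exists p, [/\ path (@adj G) x p, size p = n & last x p = y])
          (walk x y n).
Proof.
apply: (iffP existsP) => [[p /andP[px /eqP ly]]|[p [px <- ly]]].
  by exists p; rewrite size_tuple.
by exists (in_tuple p); rewrite px ly eqxx.
Qed.

Lemma walk0 x : walk x x 0.
Proof. by apply/walkP; exists [::]. Qed.

Lemma walk1 x y : adj x y -> walk x y 1.
Proof. by move=> xy; apply/walkP; exists [:: y]; rewrite /= xy. Qed.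

Lemma walk_cat x y z m n : walk x y m -> walk y z n -> walk x z (m + n).
Proof.
move=> /walkP[p [px <- ly]] /walkP[q [qy <- lz]]; apply/walkP; exists (p ++ q).
by rewrite cat_path px ly size_cat last_cat ly.
Qed.

Lemma walk_sym x y n : walk x y n -> walk y x n.
Proof.
move=> /walkP[p [px <- <-]] {y n}.
elim: p x px => [|z p IHp] x /=; first by move=> _; exact: walk0.
case/andP=> xz pz; rewrite -addn1; apply: walk_cat (IHp _ pz) _.
by apply: walk1; rewrite adj_sym.
Qed.

Definition induced_path f n :=
  forall i j, i < j -> j < n -> f i != f j /\ adj (f i) (f j) = (i.+1 == j).

Lemma induced_path_has_induced f n k :
  induced_path f n -> k <= n -> has_induced G (path_graph k).
Proof.
move=> ind le_kn; have ordE (i j : 'I_k) : i < j ->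
    f i != f j /\ adj (f i) (f j) = (i.+1 == j).
  by move=> lt_ij; apply: ind => //; apply: leq_trans le_kn.
exists (fun i : 'I_k => f i) => [i j /eqP eq_f|i j].
  case: (ltngtP i j) => [/ordE[]|/ordE[]|/val_inj//]; first by rewrite eq_f.
  by rewrite eq_sym eq_f.
rewrite /= /path_adj /=; case: (ltngtP i j) => [lt_ij|lt_ij|eq_ij].
- by have [_ ->] := ordE _ _ lt_ij; rewrite (_ : j.+1 == i = false) ?orbF //; lia.
- have [_] := ordE _ _ lt_ij; rewrite adj_sym => ->.
  by rewrite (_ : i.+1 == j = false) //; lia.
- by rewrite (val_inj eq_ij) adj_irrefl orbb; lia.
Qed.

Lemma induced_path_shift f n : induced_path f n.+1 -> induced_path (f \o S) n.
Proof. by move=> ind i j lt_ij lt_jn; rewrite -eqSS; apply: ind. Qed.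

(** Runs backwards along [f] to [f 0], crosses the only edge between the two paths to [h 0], and
    continues forwards along [h]. *)
Lemma induced_path_glue f h m n :
  induced_path f m -> induced_path h n ->
  (forall i j, i < m -> j < n ->
     f i != h j /\ adj (f i) (h j) = (i == 0) && (j == 0)) ->
  induced_path (fun i => if i < m then f (m.-1 - i) else h (i - m)) (m + n).
Proof.
move=> indf indh fh i j lt_ij lt_jmn.
case: (ltnP i m) => lt_im; case: (ltnP j m) => lt_jm; try lia.
- have [|| ne_f adj_f] := indf (m.-1 - j) (m.-1 - i); [lia|lia|].
  by rewrite eq_sym adj_sym; split=> //; rewrite adj_f; lia.
- by have [|| ne_f ->] := fh (m.-1 - i) (j - m); lia.
- by have [|| ne_f ->] := indh (i - m) (j - m); lia.
Qed.

End Walks.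

(** * Distances and geodesics *)

Section Distance.
Variables (G : sgraph) (hconn : connected_graph G).
Implicit Types (x y z : G) (f : nat -> G).

Definition dist x y := ex_minn (connect_walk (hconn x y)).

Lemma dist_walk x y : walk x y (dist x y).
Proof. by rewrite /dist; case: ex_minnP. Qed.

Lemma dist_le_walk x y n : walk x y n -> dist x y <= n.
Proof. by rewrite /dist; case: ex_minnP => m _; apply. Qed.

Lemma gdist_leE x y n : gdist_le x y n = (dist x y <= n).
Proof.
apply/gdist_leP/idP => [[m /dist_le_walk]|le_n]; first exact: leq_trans.
by exists (dist x y) => //; apply: dist_walk.
Qed.

Lemma distxx x : dist x x = 0.
Proof. by apply/eqP; rewrite -leqn0 dist_le_walk ?walk0. Qed.

Lemma dist0_eq x y : dist x y = 0 -> x = y.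
Proof. by move=> d0; have := dist_walk x y; rewrite d0 => /walkP[[|z p] [_ // _ <-]]. Qed.

Lemma dist_sym x y : dist x y = dist y x.
Proof.
by apply/eqP; rewrite eqn_leq !dist_le_walk // walk_sym // dist_walk.
Qed.

Lemma dist_triangle y x z : dist x z <= dist x y + dist y z.
Proof. by apply: dist_le_walk; apply: walk_cat (dist_walk _ _) (dist_walk _ _). Qed.

Lemma dist_adj x y : adj x y -> dist x y <= 1.
Proof. by move/walk1/dist_le_walk. Qed.

Definition geodesic f n :=
  forall i j, i <= j -> j <= n ->
    dist (f i) (f j) = j - i /\ (i.+1 = j -> adj (f i) (f j)).

Lemma geodesicP x y : exists f, [/\ f 0 = x, f (dist x y) = y & geodesic f (dist x y)].
Proof.
have /walkP[p [px sz_p last_p]] := dist_walk x y.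
pose f := nth x (x :: p); exists f.
have f_n : f (dist x y) = y by rewrite /f -sz_p -last_p nth_last.
have f_adj i : i < dist x y -> adj (f i) (f i.+1).
  by rewrite -sz_p => lt_i; have /(pathP x) := px; apply.
have f_le i j : i <= j -> j <= dist x y -> dist (f i) (f j) <= j - i.
  elim: j => [|j IHj] le_ij le_j; first by move: le_ij; rewrite leqn0 => /eqP->; rewrite distxx.
  move: le_ij; rewrite leq_eqVlt => /predU1P[->|le_ij]; first by rewrite distxx.
  have := dist_triangle (f j) (f i) (f j.+1).
  have := dist_adj (f_adj j le_j); have := IHj le_ij (ltnW le_j); lia.
split=> // i j le_ij le_jn; split; last by move=> eq_j; rewrite -eq_j f_adj // eq_j.
have := f_le _ _ le_ij le_jn.
(* With n = d(x,y), the chain n <= d(x, f i) + d(f i, f j) + d(f j, y) <= i + d(f i, f j) + (n - j)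
   gives the lower bound j - i. *)
have := f_le _ _ (leq0n i) (leq_trans le_ij le_jn).
have := f_le _ _ le_jn (leqnn _); rewrite f_n (erefl : f 0 = x).
have := dist_triangle (f i) x y; have := dist_triangle (f j) (f i) y; lia.
Qed.

Lemma geodesic_induced_path f n : geodesic f n -> induced_path f n.+1.
Proof.
move=> geo i j lt_ij lt_jn; have [dij adj_ij] := geo i j (ltnW lt_ij) lt_jn.
split; first by apply/eqP => eq_f; move: dij; rewrite eq_f distxx; lia.
case: eqP => [/adj_ij //|ne_ij]; apply/negP => /dist_adj; lia.
Qed.

(* Minimality enters only through the hypothesis that [v] is the unique vertex
   at distance more than [r.-1] from [c]. *)
Lemma unique_far_vertex_induced_path r (c v : G) :
  2 <= r -> (forall x, exists y, r <= dist x y) ->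
  dist c v = r -> (forall y, y != v -> dist c y < r) ->
  has_induced G (path_graph r.*2.-1).
Proof.
move=> ge2_r far dcv near.
have [x [x0 xr geo_x]] := geodesicP c v; rewrite dcv in xr geo_x.
have [w far_w] := far (x 2).
have ne_wv : w != v.
  apply/eqP => eq_wv; move: far_w.
  by rewrite eq_wv -xr; have [-> _] := geo_x 2 r ge2_r (leqnn r); lia.
have dcw := near w ne_wv.
have [q [q0 qs geo_q]] := geodesicP c w; set s := dist c w in dcw qs geo_q.
have dcx i : i <= r -> dist c (x i) = i.
  by move=> le_i; rewrite -x0; have [->] := geo_x 0 i (leq0n i) le_i; lia.
have dcq j : j <= s -> dist c (q j) = j.
  by move=> le_j; rewrite -q0; have [->] := geo_q 0 j (leq0n j) le_j; lia.
have dx2x i : i <= r -> dist (x 2) (x i) = (2 - i) + (i - 2).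
  move=> le_i; case: (leqP 2 i) => le_2i.
    by have [-> _] := geo_x 2 i le_2i le_i; lia.
  by rewrite dist_sym; have [-> _] := geo_x i 2 (ltnW le_2i) ge2_r; lia.
have dx2q j : j <= s -> r - (s - j) <= dist (x 2) (q j).
  move=> le_j; have := dist_triangle (q j) (x 2) w; rewrite -qs.
  by have [-> _] := geo_q j s le_j (leqnn s); rewrite qs; lia.
have le_rs : r <= s.+2.
  have := dist_triangle c (x 2) w; rewrite -/s (dist_sym (x 2) c) dcx //; lia.
(* Distances from c force i = j; then |i - 1| >= r - s + j + 1 >= i + 2, which is impossible. *)
have ne_xq i j : i < r -> j < s -> x i.+1 != q j.+1.
  move=> le_i le_j; apply/eqP => eq_xq.
  have := dcx _ le_i; have := dcq _ le_j; have := dx2x _ le_i.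
  by have := dx2q _ le_j; rewrite -eq_xq; lia.
(* Here |i - j| <= 1 and r - s + j + 1 <= |i - 1| + 1. For i >= 1 this contradicts s < r; for i = 0
   it leaves only j = 0 and s = r - 1. *)
have adj_xq i j : i < r -> j < s -> adj (x i.+1) (q j.+1) ->
    [/\ i = 0, j = 0 & s = r.-1].
  move=> le_i le_j xq; have d1 := dist_adj xq.
  have := dcx _ le_i; have := dcq _ le_j; have := dx2x _ le_i; have := dx2q _ le_j.
  have := dist_triangle (x i.+1) c (q j.+1).
  have := dist_triangle (q j.+1) c (x i.+1); rewrite (dist_sym (q j.+1)).
  have := dist_triangle (x i.+1) (x 2) (q j.+1).
  by move=> *; split; lia.
have ind_x := geodesic_induced_path geo_x.
have ind_q := geodesic_induced_path geo_q.
have ind_qS := induced_path_shift ind_q.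
(* If s = 0, which r = 2 allows, [q 1] lies beyond the end of the geodesic; hence the test 0 < s. *)
have [/andP[s_gt0 x1q1]|no_edge] := boolP ((0 < s) && adj (x 1) (q 1)).
  have [||_ _ s_eq] := adj_xq 0 0 _ _ x1q1; [lia|lia|].
  apply: (induced_path_has_induced
            (induced_path_glue (induced_path_shift ind_x) ind_qS _)); last by lia.
  move=> i j lt_i lt_j; split; first exact: ne_xq.
  apply/idP/andP => [xq|[/eqP-> /eqP->] //].
  by have [-> ->] := adj_xq i j lt_i lt_j xq.
apply: (induced_path_has_induced (induced_path_glue ind_x ind_qS _)); last by lia.
case=> [|i] j lt_i lt_j.
  by rewrite x0 -q0 /= -[j == 0]eqSS [j.+1 == 1]eq_sym; apply: ind_q.
split; first exact: ne_xq.
apply/negbTE/negP => xq; have [i0 j0 _] := adj_xq i j lt_i lt_j xq.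
by case/negP: no_edge; rewrite (leq_trans _ lt_j) // -{1}i0 -{1}j0.
Qed.

End Distance.

(** * Deleting a vertex *)

Section DeleteVertex.
Variables (G : sgraph) (v : G).

Definition delete_adj : rel {x : G | x != v} :=
  fun x y => adj (val x) (val y).

Lemma delete_adj_sym : symmetric delete_adj.
Proof. by move=> x y; apply: adj_sym. Qed.

Lemma delete_adj_irrefl : irreflexive delete_adj.
Proof. by move=> x; apply: adj_irrefl. Qed.

Definition delete_vertex := SGraph delete_adj_sym delete_adj_irrefl.

Lemma delete_vertex_has_induced (H : sgraph) :
  has_induced delete_vertex H -> has_induced G H.
Proof.
case=> f f_inj f_adj; exists (fun x => val (f x)) => [x y /val_inj/f_inj //|x y].
by rewrite -f_adj.
Qed.

Lemma delete_vertex_walk (x y : delete_vertex) n :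
  walk x y n -> walk (val x) (val y) n.
Proof.
move=> /walkP[p [px sz_p ly]]; apply/walkP; exists (map val p).
by rewrite size_map last_map ly path_map.
Qed.

(** A geodesic from [u] to a vertex other than [v] avoids [v]: its earlier vertices are strictly
    closer to [u] than its end, while [v] is farthest. *)
Lemma farthest_delete_connected (hconn : connected_graph G) (u : G) :
  u != v -> (forall y, dist hconn u y <= dist hconn u v) ->
  connected_graph delete_vertex.
Proof.
move=> ne_uv far_v; pose u' : delete_vertex := Sub u ne_uv.
suff conn_u n (x : delete_vertex) :
    dist hconn u (val x) = n -> connect (@adj delete_vertex) u' x.
  move=> x y; apply: connect_trans (conn_u _ y erefl).
  by rewrite (sym_connect_sym (@adj_sym _)); apply: conn_u.
elim: n x => [|n IHn] x dx.
  by rewrite (_ : x = u') ?connect0 //; apply/val_inj/esym/(dist0_eq dx).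
have [f [f0 fx geo]] := geodesicP hconn u (val x); rewrite dx in fx geo.
have [dy _] := geo 0 n (leq0n n) (leqnSn n); rewrite f0 subn0 in dy.
have [_ adj_y] := geo n n.+1 (leqnSn n) (leqnn _).
have ne_yv : f n != v.
  by apply/eqP => eq_y; have := far_v (val x); rewrite dx -eq_y dy ltnn.
apply: connect_trans (IHn (Sub (f n) ne_yv) dy) (connect1 _).
by rewrite /= /delete_adj /= -fx; apply: adj_y.
Qed.

End DeleteVertex.

(** * From large eccentricities to the burning bound *)

Theorem large_radius_induced_path (r : nat) (G : sgraph)
    (hconn : connected_graph G) :
  2 <= r -> 0 < #|G| -> (forall x, exists y, r <= dist hconn x y) ->
  has_induced G (path_graph r.*2.-1).
Proof.
move=> ge2_r; move: {2}#|G| (leqnn #|G|) => n.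
elim: n G hconn => [|n IHn] G hconn; first by case: #|G|.
move=> le_Gn /card_gt0P[u _] far.
(* A vertex farthest from [u] serves as the non-cut vertex. *)
pose v := [arg max_(y > u) dist hconn u y].
have far_v y : dist hconn u y <= dist hconn u v.
  by rewrite /v; case: arg_maxnP => // z _; apply.
have ne_uv : u != v.
  have [y far_y] := far u; apply/eqP => eq_uv.
  by have := far_v y; rewrite -eq_uv distxx; lia.
have hconn' := farthest_delete_connected ne_uv far_v.
have [far'|] := boolP [forall x, exists y, r <= dist hconn' x y].
  apply/delete_vertex_has_induced/(IHn _ hconn').
  - by rewrite card_sig cardC1; lia.
  - by apply/card_gt0P; exists (Sub u ne_uv).
  - by move=> x; apply/existsP; move/forallP: far'; apply.
rewrite negb_forall => /existsP[[c ne_cv]]; rewrite negb_exists => /forallP near'.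
(* Walks that avoid [v] are walks of [G], so distances in [G] are at most those after the
   deletion. *)
have near y : y != v -> dist hconn c y < r.
  move=> ne_yv; have := near' (Sub y ne_yv); rewrite -ltnNge; apply: leq_ltn_trans.
  exact: dist_le_walk (delete_vertex_walk (dist_walk hconn' _ _)).
apply: (@unique_far_vertex_induced_path _ hconn r c v) => //.
have le_rv : r <= dist hconn c v.
  have [y far_y] := far c; case: (eqVneq y v) => [<- //|/near]; lia.
apply/eqP; rewrite eqn_leq le_rv andbT.
(* The vertex before [v] on a geodesic from [c] differs from [v], so d - 1 < r. *)
have [f [f0 fv geo]] := geodesicP hconn c v; set d := dist hconn c v in le_rv fv geo *.
have [||d1 _] := geo 0 d.-1; [lia|lia|].
have [||d2 _] := geo d.-1 d; [lia|lia|].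
have /near : f d.-1 != v.
  by apply/eqP => eq_f; move: d2; rewrite eq_f fv distxx; lia.
by rewrite -f0 d1; lia.
Qed.

Theorem theorem4 (k : nat) (G : sgraph) (hk : 2 <= k)
  (hconn : connected_graph G) (hfree : path_free k G) :
  burning_number G <= uphalf k.+1.
Proof.
rewrite /burning_number; case: ex_minnP => b _ min_b.
have [G0|G_gt0] := posnP #|G|.
  (* The empty graph is burned by the empty sequence. *)
  rewrite (leq_trans (min_b 0 _)) //; apply/existsP; exists [tuple].
  by apply/forallP => v; have := fintype0 v.
set t := uphalf k.+1; have ge2_t : 2 <= t by rewrite /t; lia.
have [/existsP[c /forallP near]|] :=
    boolP [exists c : G, forall v, dist hconn c v < t].
  (* Index 0 carries radius t - 1, so its entry [c] alone reaches every vertex. *)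
  apply/min_b/existsP; exists (nseq_tuple t c); apply/forallP => v.
  apply/existsP; exists (Ordinal (ltnW ge2_t)).
  rewrite gdist_leE tnth_nseq dist_sym subn1 /=; have := near v; lia.
rewrite negb_exists => /forallP far; case: hfree.
have [x|f f_inj f_adj] := large_radius_induced_path (hconn := hconn) ge2_t G_gt0.
  have := far x; rewrite negb_forall => /existsP[y].
  by rewrite -leqNgt; exists y.
have le_k : k <= t.*2.-1 by rewrite /t; lia.
exists (fun i : 'I_k => f (widen_ord le_k i)) => [i j /f_inj|i j].
  by case=> eq_ij; apply: ord_inj.
exact: f_adj.
Qed.
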